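(* There exists a bijection $\pi\colon \mathcal P\to\mathcal S$ such that for every integer $n\ge 0$, $\pi(\mathcal P_n)=\mathcal S_{\operatorname{lg}=n}$. Moreover, for every $n\ge 0$, $\#\mathcal S_{\operatorname{lg}=n}=p(n)$.
   Context: $\mathcal P$ denotes the set of all integer partitions $\lambda=(\lambda_1,\dots,\lambda_r)$, $\lambda_1\ge\dots\ge\lambda_r\ge1$, including the empty partition $\emptyset$ (of size $0$ and length $0$). $\mathcal P_n$ is the set of partitions of $n$ and $p(n)=\#\mathcal P_n$. A partition $\lambda=(\lambda_1,\dots,\lambda_r)$ is called sequentially congruent if $\lambda_i\equiv\lambda_{i+1}\pmod i$ for $1\le i\le r-1$ and $\lambda_r\equiv 0\pmod r$. $\mathcal S\subseteq\mathcal P$ denotes the set of sequentially congruent partitions, and $\mathcal S_{\operatorname{lg}=n}$ the set of sequentially congruent partitions whose largest part $\lambda_1$ equals $n$ (with the empty partition regarded as having largest part $0$). *)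

(* Defs.v *)
From HB Require Import structures.
From mathcomp Require Import all_boot.
From mathcomp Require Import boolp classical_sets functions cardinality finmap.
Set Implicit Arguments.
Unset Strict Implicit.
Unset Printing Implicit Defensive.

Local Open Scope classical_set_scope.
Local Open Scope nat_scope.

Definition is_intpart (s : seq nat) : bool := sorted geq s && all (ltn 0) s.

Record intpart := IntPart { parts :> seq nat; _ : is_intpart parts }.

HB.instance Definition _ := [isSub for parts].
HB.instance Definition _ := [Countable of intpart by <:].

(* 1-based: [part l i] is the i-th part of l for 1 <= i <= size l.  On the empty
   partition [part l 0] and [part l 1] are the default 0. *)
Definition part (l : intpart) (i : nat) : nat := nth 0 l i.-1.

Definition parts_of (n : nat) : set intpart := [set l : intpart | sumn l = n].

Lemma finite_parts_of (n : nat) : finite_set (parts_of n).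
Proof.
have bnd (s : seq nat) : all (ltn 0) s -> size s <= sumn s.
  by elim: s => //= x s IHs /andP[x0 /IHs]; rewrite -add1n; apply: leq_add.
have mem_le (s : seq nat) x : x \in s -> x <= sumn s.
  elim: s => //= y s IHs; rewrite inE => /orP[/eqP->|/IHs xs].
    exact: leq_addr.
  exact: leq_trans xs (leq_addl _ _).
pose g (t : n.-bseq 'I_n.+1) : option intpart := insub [seq val i | i <- t].
apply: (@sub_finite_set _ _ (Some @^-1` (g @` setT))); last first.
  apply: finite_preimage; first by move=> x y _ _ [].
  exact/finite_image/finite_finset.
move=> [s ps] /= sn.
have [_ pos] := andP ps.
have sz : size ([seq inord i | i <- s] : seq 'I_n.+1) <= n.
  by rewrite size_map -sn bnd.
exists (Bseq sz) => //; rewrite /g /= -map_comp.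
have -> : [seq (val \o @inord n) i | i <- s] = s.
  apply: map_id_in => x xs /=; rewrite inordK// ltnS -sn; exact: mem_le.
by rewrite insubT; congr Some; apply: val_inj.
Qed.

(* p(n); meaningful by [finite_parts_of]. *)
Definition npart (n : nat) : nat := #|` fset_set (parts_of n)|.

Definition seqcong : set intpart :=
  [set l : intpart | (forall i, 1 <= i <= (size l).-1 ->
              part l i = part l i.+1 %[mod i])
        /\ part l (size l) = 0 %[mod size l]].

(* The largest part is [part l 1], which is 0 for the empty partition. *)
Definition seqcong_lg (n : nat) : set intpart :=
  [set l : intpart | seqcong l /\ part l 1 = n].

(* Main.v *)
(** The bijection sends (a_1, ..., a_r) to (b_1, ..., b_r) with
    b_i = i a_i + a_(i+1) + ... + a_r.  Then b_i - b_(i+1) = i (a_i - a_(i+1))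
    (with a_(r+1) = b_(r+1) = 0), so b is a sequentially congruent partition, the
    differences of b determine those of a, and b_1 is the size of a. *)
Require Import Defs.
From mathcomp Require Import all_boot.
From mathcomp Require Import boolp classical_sets functions cardinality finmap.
From mathcomp Require Import zify.

Local Open Scope classical_set_scope.
Local Open Scope nat_scope.

Lemma is_intpart_cons (x : nat) (s : seq nat) :
  is_intpart (x :: s) = [&& head 0 s <= x, 0 < x & is_intpart s].
Proof.
rewrite /is_intpart /=; case: s => [|y s] //=.
by rewrite andbACA -andbA.
Qed.

(* The offset [k] is the 1-based position of the head of the list in the whole
   partition; it makes recursion on tails possible. *)
Fixpoint weighted_tails (k : nat) (s : seq nat) : seq nat :=
  if s is x :: s' then k * x + sumn s' :: weighted_tails k.+1 s' else [::].

(** Past the end [nth] returns 0, so the case of the last index says that the last part is divisible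
    by its own position. *)
Definition seqcong_from (k : nat) (t : seq nat) : Prop :=
  forall i, i < size t -> nth 0 t i = nth 0 t i.+1 %[mod k + i].

Lemma seqcong_from_cons (k y : nat) (t : seq nat) :
  seqcong_from k (y :: t) <->
  y = head 0 t %[mod k] /\ seqcong_from k.+1 t.
Proof.
rewrite -nth0; split=> [H|[H0 H] [|i] /= it].
- split=> [|i it]; first by have := H 0 isT; rewrite addn0.
  by have := H i.+1 it; rewrite addSnnS.
- by rewrite addn0.
- by rewrite -addSnnS; apply: H.
Qed.

Lemma seqcongE (l : intpart) : seqcong l <-> seqcong_from 1 l.
Proof.
rewrite /seqcong /seqcong_from /part /=; split=> [[H Hlast] i il|H].
  rewrite add1n; have [il1|il1] := ltnP i.+1 (size l).
    by apply: (H i.+1); lia.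
  have E : size l = i.+1 by lia.
  by move: Hlast; rewrite E /= => ->; rewrite (nth_default _ il1).
split=> [[|i] //= il|]; first by apply: (H i); lia.
(* For the empty partition the congruence is modulo 0, hence an equality; it holds because the
   default part is 0. *)
case E: (size l) => [|n] /=; first by rewrite nth_default ?E.
by have := H n; rewrite E add1n (@nth_default _ _ _ n.+1) ?E// => ->.
Qed.

(** One copy of the head moves into the sum. An entry placed just before is [k * x + sumn s], so the
    two share the summand [sumn s] and differ by a multiple of [k]. *)
Lemma head_weighted_tails (k : nat) (s : seq nat) :
  head 0 (weighted_tails k.+1 s) = k * head 0 s + sumn s.
Proof. by case: s => [|x s] /=; lia. Qed.

(** The tails agree by induction, hence so do their sums, and [0 < k] allows cancelling [k] in front
    of the heads. *)
Lemma weighted_tails_inj (k : nat) : 0 < k -> injective (weighted_tails k).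
Proof.
move=> + s; elim: s k => [|x s IHs] k k0 [|y t] //= [E /IHs st].
have {}st := st isT; subst t; congr cons.
by apply/eqP; rewrite -(eqn_pmul2l k0); apply/eqP; lia.
Qed.

Lemma weighted_tails_is_intpart (k : nat) (s : seq nat) :
  0 < k -> is_intpart s -> is_intpart (weighted_tails k s).
Proof.
elim: s k => [|x s IHs] k k0 //=.
rewrite !is_intpart_cons head_weighted_tails => /and3P[hx x0 /IHs->//].
by rewrite leq_add2r leq_mul2l hx orbT addn_gt0 muln_gt0 k0 x0.
Qed.

Lemma weighted_tails_seqcong (k : nat) (s : seq nat) :
  seqcong_from k (weighted_tails k s).
Proof.
elim: s k => [|x s IHs] k //=; apply/seqcong_from_cons; split=> //.
by rewrite head_weighted_tails ![k * _]mulnC !modnMDl.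
Qed.

Lemma weighted_tails_surj (k : nat) (t : seq nat) :
  0 < k -> is_intpart t -> seqcong_from k t ->
  exists2 s, is_intpart s & weighted_tails k s = t.
Proof.
elim: t k => [|y t IHt] k k0; first by exists [::].
rewrite is_intpart_cons => /and3P[hy y0 tP] /seqcong_from_cons[yt].
move=> /(IHt k.+1 isT tP)[s sP st].
(* [d] is the amount by which the new part must exceed the head of [s]. *)
have /dvdnP[d dE] : k %| y - head 0 t by rewrite -eqn_mod_dvd//; apply/eqP.
have yE : y = k * (d + head 0 s) + sumn s.
  by move: dE hy; rewrite -st head_weighted_tails mulnDr (mulnC k d); lia.
exists (d + head 0 s :: s); last by rewrite /= st -yE.
rewrite is_intpart_cons leq_addl sP andbT /=.
(* Positivity of the new part: a nonempty [s] has a positive head, and for empty [s] the entry [y]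
   is [k * d], so [0 < y] excludes [d = 0]. *)
case: s sP yE {st} => [_|x s]; last first.
  by rewrite is_intpart_cons => /and3P[_ x0 _] _; rewrite addn_gt0 x0 orbT.
by move=> /= yE; move: y0; rewrite yE; case: d {dE yE} => //; rewrite muln0.
Qed.

Definition seqcong_of (l : intpart) : intpart :=
  IntPart (weighted_tails_is_intpart 1 l isT (valP l)).

Lemma part1_seqcong_of (l : intpart) : part (seqcong_of l) 1 = sumn l.
Proof. by case: l => [[|x s] sP]; rewrite /part //= mul1n. Qed.

Lemma seqcong_of_inj : injective seqcong_of.
Proof. by move=> l m [/weighted_tails_inj lm]; apply/val_inj/lm. Qed.

Lemma seqcong_of_seqcong (l : intpart) : seqcong (seqcong_of l).
Proof. exact/seqcongE/weighted_tails_seqcong. Qed.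

Lemma seqcong_of_surj (m : intpart) :
  seqcong m -> exists l, seqcong_of l = m.
Proof.
move=> /seqcongE /(weighted_tails_surj 1 m isT (valP m))[s sP sm].
by exists (IntPart sP); apply: val_inj.
Qed.

Lemma image_seqcong_of (n : nat) : seqcong_of @` parts_of n = seqcong_lg n.
Proof.
apply/seteqP; split=> [_ [l ln <-]|m [/seqcong_of_surj[l <-] ln]].
  by split; [exact: seqcong_of_seqcong | rewrite part1_seqcong_of].
by exists l => //; rewrite /parts_of /= -part1_seqcong_of.
Qed.

Theorem theorem2p1 :
  (exists pi : intpart -> intpart,
     set_bij [set: intpart] seqcong pi /\
     forall n : nat, pi @` parts_of n = seqcong_lg n) /\
  (forall n : nat,
     finite_set (seqcong_lg n) /\
     #|` fset_set (seqcong_lg n)| = npart n).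
Proof.
split.
  exists seqcong_of; split; last exact: image_seqcong_of.
  split.
  - by move=> l _; apply: seqcong_of_seqcong.
  - by move=> l m _ _; apply: seqcong_of_inj.
  - by move=> m /seqcong_of_surj[l <-]; exists l.
(* Both claims pass to an image of [parts_of n]; injectivity preserves the count. *)
move=> n; rewrite -image_seqcong_of; split.
  exact/finite_image/finite_parts_of.
rewrite fset_set_image; last exact: finite_parts_of.
by rewrite card_imfset//; apply: seqcong_of_inj.
Qed.
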